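(* Let $t\in(0,1)$. Let $p_t^0, h_i^0, v_j^0$ ($i\in[m]$, $j\in[m']$) be real polynomials in a block of variables $\mathbf z_0\in\mathbb R^3$, and let $p_t^1,h_i^1,v_j^1$ be real polynomials in a block of variables in $\mathbb R^6$, all of degree at most $2$ and all without constant term. For each integer $n\ge 1$ and $\mathbf z=(\mathbf z_0,\mathbf z_1,\dots,\mathbf z_n)$ with $\mathbf z_0\in\mathbb R^3$ and $\mathbf z_1,\dots,\mathbf z_n\in\mathbb R^6$, let $$p_t(\mathbf z)=p_t^0(\mathbf z_0)+\sum_{\ell=1}^n p_t^1(\mathbf z_\ell),\quad h_i(\mathbf z)=h_i^0(\mathbf z_0)+\sum_{\ell=1}^n h_i^1(\mathbf z_\ell),\quad v_j(\mathbf z)=v_j^0(\mathbf z_0)+\sum_{\ell=1}^n v_j^1(\mathbf z_\ell)$$ be the performance measure polynomial and the constraint functions in dimension $n$ (that is, they are separable with respect to the blocks $\mathbf z_0,\dots,\mathbf z_n$, invariant under permutations of the blocks $\mathbf z_1,\dots,\mathbf z_n$, and have no constant terms). Then a degree-1 SOS certificate for the rate $t$ in the univariate case $n=1$ can be lifted to a degree-1 SOS certificate for the same rate $t$ in the general case: if $p_t$ admits a degree-1 SOS certificate for $n=1$, then $p_t$ admits a degree-1 SOS certificate for every $n>1$.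
   Context: Notation: $[m]=\{1,\dots,m\}$. Setting: the variables arise from the one-step analysis of a first-order method on $\mathbb R^n$: $\mathbf z_0=(f_*,f_k,f_{k+1})$ and $\mathbf z_\ell=(x_*(\ell),x_k(\ell),x_{k+1}(\ell),g_*(\ell),g_k(\ell),g_{k+1}(\ell))$ for $\ell\in[n]$, where $x_*(\ell)$ denotes the $\ell$-th coordinate of $\mathbf x_*\in\mathbb R^n$, and similarly for the other vectors. The inequality constraints are $h_i(\mathbf z)\ge 0$ and the equality constraints are $v_j(\mathbf z)=0$. The polynomial $p_t$ is the performance measure polynomial for the rate $t$, e.g. $t(f_k-f_* )-(f_{k+1}-f_* )$. Degree-1 SOS certificate (in dimension $n$) for the rate $t$: a positive semidefinite matrix $Q$ of size $(1+3+6n)\times(1+3+6n)$, scalars $\sigma_i\ge 0$ ($i\in[m]$) and $\theta_j\in\mathbb R$ ($j\in[m']$) such that the following identity of polynomials in $\mathbf z$ holds: $$p_t(\mathbf z)=\begin{pmatrix}1\\ \mathbf z\end{pmatrix}^{\top}Q\begin{pmatrix}1\\ \mathbf z\end{pmatrix}+\sum_{i=1}^m\sigma_i h_i(\mathbf z)+\sum_{j=1}^{m'}\theta_j v_j(\mathbf z).$$ *)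

(* Defs.v *)
From mathcomp Require Import all_boot all_order all_algebra.
From mathcomp Require Import reals.
From mathcomp Require Import mpoly.

Set Implicit Arguments.
Unset Strict Implicit.
Unset Printing Implicit Defensive.

Import Order.TTheory GRing.Theory Num.Theory.
Local Open Scope ring_scope.

(* z = (z_0, z_1, ..., z_n) with z_0 in R^3 and z_1, ..., z_n in R^6. *)
Definition nvars (n : nat) : nat := (3 + n * 6)%N.

Definition z0_index (n : nat) (c : 'I_3) : 'I_(nvars n) := lshift (n * 6) c.

Definition block_index (n : nat) (l : 'I_n) (c : 'I_6) : 'I_(nvars n) :=
  rshift 3 (mxvec_index l c).

(* The polynomial q0(z_0) + \sum_(l < n) q1(z_l). *)
Definition separable_poly (R : realType) (n : nat)
    (q0 : {mpoly R[3]}) (q1 : {mpoly R[6]}) : {mpoly R[nvars n]} :=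
  comp_mpoly [tuple 'X_(z0_index n c) | c < 3] q0
  + \sum_(l < n) comp_mpoly [tuple 'X_(block_index l c) | c < 6] q1.

(* [msize] is the total degree plus one (and 0 for the zero polynomial). *)
Definition deg_le2_no_const (R : realType) (k : nat) (q : {mpoly R[k]}) : Prop :=
  (msize q <= 3)%N /\ q@_0%MM = 0.

Definition psdmx (R : realType) (k : nat) (Q : 'M[R]_k) : Prop :=
  Q^T = Q /\ forall u : 'cV[R]_k, 0 <= (u^T *m Q *m u) 0 0.

Definition monom1 (R : realType) (N : nat) : 'cV[{mpoly R[N]}]_(1 + N) :=
  col_mx 1%:M (\col_(i < N) 'X_i).

Definition qform1 (R : realType) (N : nat) (Q : 'M[R]_(1 + N)) : {mpoly R[N]} :=
  ((monom1 R N)^T *m map_mx (@mpolyC N R) Q *m monom1 R N) 0 0.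

Definition sos1_certificate (R : realType) (N m m' : nat) (p : {mpoly R[N]})
    (h : 'I_m -> {mpoly R[N]}) (v : 'I_m' -> {mpoly R[N]}) : Prop :=
  exists (Q : 'M[R]_(1 + N)) (sigma : 'I_m -> R) (theta : 'I_m' -> R),
    [/\ psdmx Q,
        (forall i, 0 <= sigma i)
      & p = qform1 Q + \sum_(i < m) sigma i *: h i
                     + \sum_(j < m') theta j *: v j].

(* Main.v *)
Require Import Defs.
From mathcomp Require Import all_boot all_order all_algebra.
From mathcomp Require Import reals.
From mathcomp Require Import mpoly.

Set Implicit Arguments.
Unset Strict Implicit.
Unset Printing Implicit Defensive.

Import Order.TTheory GRing.Theory Num.Theory.
Local Open Scope ring_scope.

(** The certificate for [n = 1] says that the residual
    [p - sum sigma_i h_i - sum theta_j v_j] is a positive semidefinite quadratic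
    form [q(1, z_0, z_1)].  The residual is again separable without constant
    term, say [r0(z_0) + r1(z_1)] with [r0(0) = r1(0) = 0].  Setting one of the
    two blocks to zero isolates the other summand:
      [r0(z_0) = q(1, z_0, 0)]  and  [r1(z_1) = q(1, 0, z_1)].
    With the same multipliers, the residual in dimension [n] is therefore
      [q(1, z_0, 0) + sum_l q(1, 0, z_l)],
    a sum of pullbacks of [q] along linear maps [(1, z) -> (1, A z)], hence a
    positive semidefinite quadratic form in [(1, z)].

    The substitutions are encoded by matrices [A].  Pulling back is a congruence
    [M^T Q M] of Gram matrices ([qform1_linear_forms]), which preserves
    positivity ([psdmx_congr]); its effect on a separable polynomial is computed
    in [separable_poly1_z0] and [separable_poly1_block].  The new Gram matrix is
    assembled in [qform1_separable_lift]. *)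

(** * Linear substitutions *)

Definition linear_forms (R : comNzRingType) (N N' : nat) (A : 'M[R]_(N, N')) :
    N.-tuple {mpoly R[N']} :=
  [tuple \sum_(j < N') A i j *: 'X_j | i < N].

(** Gram matrices act on [(1, z)], whose entry [1] every linear substitution
    fixes. *)
Definition homogenized_mx (R : comNzRingType) (N N' : nat) (A : 'M[R]_(N, N')) :
    'M[R]_(1 + N, 1 + N') :=
  block_mx 1%:M 0 0 A.

(** The matrix of the substitution that replaces the variable of index [f c] by
    the one of index [g c], and every variable whose index is not of the form
    [f c] by zero. *)
Definition coord_mx (R : comNzRingType) (N N' k : nat)
    (f : 'I_k -> 'I_N) (g : 'I_k -> 'I_N') : 'M[R]_(N, N') :=
  \sum_(c < k) delta_mx (f c) (g c).

(** * Positive semidefinite matrices and their quadratic forms *)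

Lemma psdmx0 (R : realType) (k : nat) : psdmx (0 : 'M[R]_k).
Proof. by split=> [|u]; rewrite ?trmx0 // mulmx0 mul0mx mxE. Qed.

Lemma psdmxD (R : realType) (k : nat) (Q Q' : 'M[R]_k) :
  psdmx Q -> psdmx Q' -> psdmx (Q + Q').
Proof.
move=> [QT Qge0] [Q'T Q'ge0]; split=> [|u]; first by rewrite linearD /= QT Q'T.
by rewrite mulmxDr mulmxDl mxE addr_ge0.
Qed.

Lemma psdmx_sum (R : realType) (k n : nat) (Q : 'I_n -> 'M[R]_k) :
  (forall l, psdmx (Q l)) -> psdmx (\sum_(l < n) Q l).
Proof.
move=> Qpsd.
by apply: (big_ind (@psdmx R k)) => //; [apply: psdmx0 | apply: psdmxD].
Qed.

Lemma psdmx_congr (R : realType) (k k' : nat) (Q : 'M[R]_k) (M : 'M[R]_(k, k')) :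
  psdmx Q -> psdmx (M^T *m Q *m M).
Proof.
move=> [QT Qge0]; split=> [|u].
  by rewrite !trmx_mul trmxK QT mulmxA.
by rewrite !mulmxA -trmx_mul -[_ *m M *m u]mulmxA.
Qed.

Lemma qform1D (R : realType) (N : nat) (Q Q' : 'M[R]_(1 + N)) :
  qform1 (Q + Q') = qform1 Q + qform1 Q'.
Proof. by rewrite /qform1 map_mxD mulmxDr mulmxDl mxE. Qed.

Lemma qform1_sum (R : realType) (N n : nat) (Q : 'I_n -> 'M[R]_(1 + N)) :
  qform1 (\sum_(l < n) Q l) = \sum_(l < n) qform1 (Q l).
Proof.
apply: (big_morph (@qform1 R N)); first exact: qform1D.
by rewrite /qform1 map_mx0 mulmx0 mul0mx mxE.
Qed.

Lemma monom1_linear_forms (R : realType) (N N' : nat) (A : 'M[R]_(N, N')) :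
  map_mx (comp_mpoly (linear_forms A)) (monom1 R N)
  = map_mx (@mpolyC N' R) (homogenized_mx A) *m monom1 R N'.
Proof.
rewrite /monom1 /homogenized_mx map_block_mx map_col_mx mul_block_col.
rewrite map_mx1 !map_mx0 !mul0mx mulmx1 addr0 add0r; congr col_mx.
  by apply/matrixP=> i j; rewrite !mxE !ord1 eqxx rmorph1.
apply/colP=> i; rewrite !mxE comp_mpolyXU -tnth_nth tnth_mktuple.
by apply: eq_bigr => j _; rewrite !mxE mul_mpolyC.
Qed.

(** Substituting the linear forms [A z] into the quadratic form [Q] is a
    congruence of Gram matrices, because it replaces [(1, z)] by
    [(1, A z) = homogenized_mx A (1, z)]. *)
Lemma qform1_linear_forms (R : realType) (N N' : nat) (Q : 'M[R]_(1 + N))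
    (A : 'M[R]_(N, N')) :
  qform1 Q \mPo linear_forms A
  = qform1 ((homogenized_mx A)^T *m Q *m homogenized_mx A).
Proof.
rewrite /qform1.
transitivity (map_mx (comp_mpoly (linear_forms A))
  ((monom1 R N)^T *m map_mx (@mpolyC N R) Q *m monom1 R N) 0 0).
  by rewrite [RHS]mxE.
rewrite !map_mxM -matrix.map_trmx monom1_linear_forms trmx_mul.
have -> : map_mx (comp_mpoly (linear_forms A)) (map_mx (@mpolyC N R) Q)
          = map_mx (@mpolyC N' R) Q.
  by apply/matrixP=> i j; rewrite !mxE comp_mpolyC.
by rewrite matrix.map_trmx !mulmxA.
Qed.

(** * Substitutions of variables by variables or zero *)

Lemma comp_mpolyA (R : comNzRingType) (k N N' : nat) (q : {mpoly R[k]})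
    (s : k.-tuple {mpoly R[N]}) (lq : N.-tuple {mpoly R[N']}) :
  (q \mPo s) \mPo lq = q \mPo [tuple tnth s c \mPo lq | c < k].
Proof.
rewrite (comp_mpolyE q s) (comp_mpolyE q [tuple _ | _ < _]) raddf_sum.
apply: eq_bigr => e _; rewrite /= comp_mpolyZ rmorph_prod; congr (_ *: _).
by apply: eq_bigr => c _; rewrite rmorphXn tnth_mktuple.
Qed.

(** This is where the absence of constant terms enters: killing the variables of
    a block must kill the polynomial of that block. *)
Lemma comp_mpoly_tuple0 (R : comNzRingType) (k N : nat) (q : {mpoly R[k]}) :
  q \mPo [tuple (0 : {mpoly R[N]}) | c < k] = (q@_0%MM)%:MP.
Proof.
rewrite comp_mpolyE [in RHS](mpolyE q) !raddf_sum; apply: eq_bigr => e _ /=.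
rewrite mcoeffZ mcoeffX -mul_mpolyC mpolyCM; congr (_ * _).
under eq_bigr => c _ do rewrite tnth_mktuple.
by rewrite prodrXr -mdegE expr0n mdeg_eq0; case: eqP => _;
  rewrite ?mpolyC1 ?mpolyC0.
Qed.

Lemma linear_forms_coord_mx (R : comNzRingType) (N N' k : nat)
    (f : 'I_k -> 'I_N) (g : 'I_k -> 'I_N') (c : 'I_k) :
  injective f -> tnth (linear_forms (coord_mx R f g)) (f c) = 'X_(g c).
Proof.
move=> f_inj; rewrite tnth_mktuple (bigD1 (g c)) //= big1 => [|j j_neq].
  rewrite summxE (bigD1 c) //= big1 => [|c' c'_neq].
    by rewrite mxE !eqxx !addr0 scale1r.
  by rewrite mxE (inj_eq f_inj) eq_sym (negPf c'_neq).
rewrite summxE big1 ?scale0r // => c' _; rewrite mxE (inj_eq f_inj).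
by have [<-|//] := eqVneq c c'; rewrite (negPf j_neq).
Qed.

Lemma linear_forms_coord_mx_notin (R : comNzRingType) (N N' k : nat)
    (f : 'I_k -> 'I_N) (g : 'I_k -> 'I_N') (i : 'I_N) :
  (forall c, f c != i) -> tnth (linear_forms (coord_mx R f g)) i = 0.
Proof.
move=> i_notin; rewrite tnth_mktuple big1 // => j _.
rewrite summxE big1 ?scale0r // => c _.
by rewrite mxE eq_sym (negPf (i_notin c)).
Qed.

(** * Residuals of separable problems *)

(** The part of [p] that a certificate with multipliers [sigma] and [theta]
    must represent by a positive semidefinite form. *)
Definition residual (R : realType) (k m m' : nat)
    (sigma : 'I_m -> R) (theta : 'I_m' -> R) (p : {mpoly R[k]})
    (h : 'I_m -> {mpoly R[k]}) (v : 'I_m' -> {mpoly R[k]}) : {mpoly R[k]} :=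
  p - \sum_(i < m) sigma i *: h i - \sum_(j < m') theta j *: v j.

Lemma residual_eq (R : realType) (k m m' : nat)
    (sigma : 'I_m -> R) (theta : 'I_m' -> R) (p q : {mpoly R[k]})
    (h : 'I_m -> {mpoly R[k]}) (v : 'I_m' -> {mpoly R[k]}) :
  residual sigma theta p h v = q
  <-> p = q + \sum_(i < m) sigma i *: h i + \sum_(j < m') theta j *: v j.
Proof.
by rewrite /residual; split=> [<-|->]; rewrite addrAC ?subrK ?addrK.
Qed.

Lemma residual_no_const (R : realType) (k m m' : nat)
    (sigma : 'I_m -> R) (theta : 'I_m' -> R) (p : {mpoly R[k]})
    (h : 'I_m -> {mpoly R[k]}) (v : 'I_m' -> {mpoly R[k]}) :
  p@_0%MM = 0 -> (forall i, (h i)@_0%MM = 0) -> (forall j, (v j)@_0%MM = 0) ->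
  (residual sigma theta p h v)@_0%MM = 0.
Proof.
move=> p_const h_const v_const.
rewrite /residual !mcoeffB p_const ![(\sum_(i < _) _)@__]raddf_sum /=.
rewrite !big1 ?subr0 // => [j|i] _.
  by rewrite mcoeffZ v_const mulr0.
by rewrite mcoeffZ h_const mulr0.
Qed.

Lemma separable_polyB (R : realType) (n : nat)
    (q0 q0' : {mpoly R[3]}) (q1 q1' : {mpoly R[6]}) :
  separable_poly n (q0 - q0') (q1 - q1')
  = separable_poly n q0 q1 - separable_poly n q0' q1'.
Proof.
rewrite /separable_poly opprD addrACA -raddfB; congr (_ + _).
by rewrite -sumrB; apply: eq_bigr => l _; rewrite raddfB.
Qed.

Lemma separable_poly_lincomb (R : realType) (n m : nat) (a : 'I_m -> R)
    (q0 : 'I_m -> {mpoly R[3]}) (q1 : 'I_m -> {mpoly R[6]}) :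
  separable_poly n (\sum_(i < m) a i *: q0 i) (\sum_(i < m) a i *: q1 i)
  = \sum_(i < m) a i *: separable_poly n (q0 i) (q1 i).
Proof.
rewrite /separable_poly raddf_sum.
under [RHS]eq_bigr => i _ do rewrite scalerDr [X in _ + X]scaler_sumr.
rewrite [RHS]big_split /= [X in _ = _ + X]exchange_big /=; congr (_ + _).
  by apply: eq_bigr => i _; rewrite comp_mpolyZ.
apply: eq_bigr => l _; rewrite raddf_sum.
by apply: eq_bigr => i _; rewrite /= comp_mpolyZ.
Qed.

Lemma separable_poly_residual (R : realType) (n m m' : nat)
    (sigma : 'I_m -> R) (theta : 'I_m' -> R)
    (p0 : {mpoly R[3]}) (p1 : {mpoly R[6]})
    (h0 : 'I_m -> {mpoly R[3]}) (h1 : 'I_m -> {mpoly R[6]})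
    (v0 : 'I_m' -> {mpoly R[3]}) (v1 : 'I_m' -> {mpoly R[6]}) :
  separable_poly n (residual sigma theta p0 h0 v0) (residual sigma theta p1 h1 v1)
  = residual sigma theta (separable_poly n p0 p1)
      (fun i => separable_poly n (h0 i) (h1 i))
      (fun j => separable_poly n (v0 j) (v1 j)).
Proof. by rewrite !separable_polyB !separable_poly_lincomb. Qed.

(** * Lifting from one block to several *)

Lemma block_index_inj (n : nat) (l l' : 'I_n) (c c' : 'I_6) :
  block_index l c = block_index l' c' -> (l, c) = (l', c').
Proof. by move=> /rshift_inj /cast_ord_inj /enum_rank_inj. Qed.

Lemma z0_index_neq_block (n : nat) (l : 'I_n) (c : 'I_3) (c' : 'I_6) :
  z0_index n c != block_index l c'.
Proof. by rewrite eq_lrshift. Qed.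

(** The substitution is [z_1 = 0]: the second summand becomes its constant term,
    and [z_0] keeps its place among the variables of dimension [n]. *)
Lemma separable_poly1_z0 (R : realType) (n : nat)
    (q0 : {mpoly R[3]}) (q1 : {mpoly R[6]}) :
  q1@_0%MM = 0 ->
  separable_poly 1 q0 q1
    \mPo linear_forms (coord_mx R (@z0_index 1) (@z0_index n))
  = q0 \mPo [tuple 'X_(z0_index n c) | c < 3].
Proof.
move=> q1_const; rewrite /separable_poly big_ord1 rmorphD /= !comp_mpolyA.
rewrite -[RHS]addr0; congr (_ + _).
  congr (q0 \mPo _); apply: eq_mktuple => c.
  rewrite tnth_mktuple comp_mpolyXU -tnth_nth linear_forms_coord_mx //.
  exact: lshift_inj.
transitivity (q1 \mPo [tuple (0 : {mpoly R[nvars n]}) | c < 6]).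
  congr (q1 \mPo _); apply: eq_mktuple => c.
  rewrite tnth_mktuple comp_mpolyXU -tnth_nth.
  rewrite linear_forms_coord_mx_notin // => c'.
  exact: z0_index_neq_block.
by rewrite comp_mpoly_tuple0 q1_const mpolyC0.
Qed.

(** The substitution is [z_0 = 0], [z_1 = z_l]: the first summand becomes its
    constant term, and the single block of dimension one moves to place [l]. *)
Lemma separable_poly1_block (R : realType) (n : nat) (l : 'I_n)
    (q0 : {mpoly R[3]}) (q1 : {mpoly R[6]}) :
  q0@_0%MM = 0 ->
  separable_poly 1 q0 q1
    \mPo linear_forms (coord_mx R (@block_index 1 ord0) (block_index l))
  = q1 \mPo [tuple 'X_(block_index l c) | c < 6].
Proof.
move=> q0_const; rewrite /separable_poly big_ord1 rmorphD /= !comp_mpolyA.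
rewrite -[RHS]add0r; congr (_ + _); last first.
  congr (q1 \mPo _); apply: eq_mktuple => c.
  rewrite tnth_mktuple comp_mpolyXU -tnth_nth linear_forms_coord_mx //.
  by move=> c1 c2 /block_index_inj [].
transitivity (q0 \mPo [tuple (0 : {mpoly R[nvars n]}) | c < 3]).
  congr (q0 \mPo _); apply: eq_mktuple => c.
  rewrite tnth_mktuple comp_mpolyXU -tnth_nth.
  rewrite linear_forms_coord_mx_notin // => c'.
  by rewrite eq_sym z0_index_neq_block.
by rewrite comp_mpoly_tuple0 q0_const mpolyC0.
Qed.

(** The summand [r0(z_0)] and each copy [r1(z_l)] are pullbacks of the one form
    [Q], so that the sum of the congruent Gram matrices represents the separable
    polynomial in dimension [n]. *)
Lemma qform1_separable_lift (R : realType) (q0 : {mpoly R[3]})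
    (q1 : {mpoly R[6]}) (Q : 'M[R]_(1 + nvars 1)) (n : nat) :
  q0@_0%MM = 0 -> q1@_0%MM = 0 -> psdmx Q -> separable_poly 1 q0 q1 = qform1 Q ->
  exists2 Q' : 'M[R]_(1 + nvars n), psdmx Q' & separable_poly n q0 q1 = qform1 Q'.
Proof.
move=> q0_const q1_const Qpsd q_eq.
pose M0 := homogenized_mx (coord_mx R (@z0_index 1) (@z0_index n)).
pose M (l : 'I_n) :=
  homogenized_mx (coord_mx R (@block_index 1 ord0) (block_index l)).
exists (M0^T *m Q *m M0 + \sum_(l < n) (M l)^T *m Q *m M l).
  apply: psdmxD; first exact: psdmx_congr.
  by apply: psdmx_sum => l; apply: psdmx_congr.
rewrite qform1D qform1_sum -qform1_linear_forms -q_eq separable_poly1_z0 //.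
congr (_ + _); apply: eq_bigr => l _.
by rewrite -qform1_linear_forms -q_eq separable_poly1_block.
Qed.

Theorem theorem2 (R : realType) (t : R) (ht0 : 0 < t) (ht1 : t < 1)
    (m m' : nat)
    (p0 : R -> {mpoly R[3]}) (p1 : R -> {mpoly R[6]})
    (h0 : 'I_m -> {mpoly R[3]}) (h1 : 'I_m -> {mpoly R[6]})
    (v0 : 'I_m' -> {mpoly R[3]}) (v1 : 'I_m' -> {mpoly R[6]})
    (hp0 : deg_le2_no_const (p0 t)) (hp1 : deg_le2_no_const (p1 t))
    (hh0 : forall i, deg_le2_no_const (h0 i))
    (hh1 : forall i, deg_le2_no_const (h1 i))
    (hv0 : forall j, deg_le2_no_const (v0 j))
    (hv1 : forall j, deg_le2_no_const (v1 j)) :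
  sos1_certificate (separable_poly 1 (p0 t) (p1 t))
    (fun i => separable_poly 1 (h0 i) (h1 i))
    (fun j => separable_poly 1 (v0 j) (v1 j)) ->
  forall n : nat, (1 < n)%N ->
    sos1_certificate (separable_poly n (p0 t) (p1 t))
      (fun i => separable_poly n (h0 i) (h1 i))
      (fun j => separable_poly n (v0 j) (v1 j)).
Proof.
move=> [Q [sigma [theta [Qpsd sigma_ge0 p_eq]]]] n _.
pose r0 := residual sigma theta (p0 t) h0 v0.
pose r1 := residual sigma theta (p1 t) h1 v1.
have r0_const : r0@_0%MM = 0.
  by apply: residual_no_const => [|i|j];
    [case: hp0 | case: (hh0 i) | case: (hv0 j)].
have r1_const : r1@_0%MM = 0.
  by apply: residual_no_const => [|i|j];
    [case: hp1 | case: (hh1 i) | case: (hv1 j)].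
have r_eq : separable_poly 1 r0 r1 = qform1 Q.
  by rewrite separable_poly_residual; apply/residual_eq.
have [Q' Q'psd r_lift] := qform1_separable_lift n r0_const r1_const Qpsd r_eq.
exists Q', sigma, theta; split=> //.
by apply/residual_eq; rewrite -separable_poly_residual.
Qed.
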